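(* Let $p$ be a prime, let $a\in\mathbb{Z}$, and let $l,l',m$ be positive integers with $l'\geqslant l>m/p$ and $$l'\equiv l \pmod{(p-1)p^{\lfloor\log_p m\rfloor-\delta_p(a,m)}},$$ where $\delta_p(a,m)=1$ if $p\mid a$ and $\log_p m$ is a positive integer, and $\delta_p(a,m)=0$ otherwise. Then $$\sum_{j=0}^{l'}\binom{l'}{j}S(j,m)a^{l'-j}\equiv\sum_{j=0}^{l}\binom{l}{j}S(j,m)a^{l-j}\pmod p.$$
   Context: $S(j,m)$ denotes the Stirling number of the second kind: for $j+m>0$ it is the number of ways to partition a set of $j$ elements into $m$ nonempty subsets, and $S(0,0)=1$. Equivalently $x^j=\sum_{i=0}^{j}S(j,i)(x)_i$ where $(x)_i=\prod_{0\le t<i}(x-t)$. The convention $0^0=1$ is used. *)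

(* Defs.v *)
From mathcomp Require Import all_boot all_order all_algebra.

Set Implicit Arguments.
Unset Strict Implicit.
Unset Printing Implicit Defensive.

Import Order.TTheory GRing.Theory Num.Theory.

(* [partition] excludes empty blocks, and the empty family is the unique
   partition of the empty set, so that [stirling2 0 0] is 1. *)
Definition stirling2 (j m : nat) : nat :=
  #|[set P : {set {set 'I_j}} | partition P [set: 'I_j] & #|P| == m]|.

(* For p > 1 and m > 0, [trunc_log p m] is the floor of log_p m; thus log_p m
   is an integer exactly when p to that power is m. *)
Definition delta (p : nat) (a : int) (m : nat) : nat :=
  if [&& (p%:Z %| a)%Z, 0 < trunc_log p m & p ^ trunc_log p m == m]
  then 1 else 0.

(* Main.v *)
(** Let L_m be the linear functional on F_p[X] sending X^j to S(j, m); over Z it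
    extracts the coefficient of the falling factorial (X)_m.  The recurrence of
    the Stirling numbers says L_m ((X - m) g) = L_(m-1) g, so L_m kills every
    multiple of X (X - 1) ... (X - m).  Modulo p, the two sums of the theorem
    differ by L_m (Y^l' - Y^l), where Y = X + a.  In F_p[X], with e the exponent
    of p in the modulus,
      X (X - 1) ... (X - m) | (X^p - X)^q = (Y^p - Y)^q = Y^q (Y^(p-1) - 1)^q
    for q = floor(m/p) + 1 <= min(l, p^e), and this divides
      Y^l (Y^(p-1) - 1)^(p^e) = Y^l (Y^((p-1) p^e) - 1) | Y^l' - Y^l.
    If p | a and m is a positive power of p, the factor X - m is X = Y, so
    already the exponent q = m/p = p^e of Y^(p-1) - 1 suffices. *)

Require Import Defs.
From HB Require Import structures.
From mathcomp Require Import all_boot all_order all_algebra all_field.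

Set Implicit Arguments.
Unset Strict Implicit.
Unset Printing Implicit Defensive.

Import Order.TTheory GRing.Theory Num.Theory.
Local Open Scope ring_scope.

Section SetPartition.
Variable T : finType.
Implicit Types (x : T) (B C D : {set T}) (P : {set {set T}}).

Lemma partition_notin P D B x :
  partition P D -> x \in B -> x \notin D -> B \notin P.
Proof.
move=> partP xB; apply: contraNN => BP.
exact: (subsetP (partitionS partP BP)).
Qed.

Lemma partition_setD1_set0 P D : partition P D -> P :\ set0 = P.
Proof.
move=> partP; apply/setP=> B; rewrite !inE.
by have [->|//] := eqVneq B set0; rewrite (partition0 partP).
Qed.

Lemma partitionU1_setD1_set0 P D C :
  partition P D -> [disjoint C & D] -> partition ((C |: P) :\ set0) (C :|: D).
Proof.
move=> partP disjCD; have [->|C_neq0] := eqVneq C set0.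
  by rewrite setU1K ?(partition0 partP) // set0U.
have partCP := partitionU1 partP C_neq0 disjCD.
by rewrite (partition_setD1_set0 partCP).
Qed.

Lemma partitionD1_set0U P D C :
  partition P D -> C \in set0 |: P -> partition (P :\ C) (D :\: C).
Proof.
move=> partP; rewrite !inE => /predU1P[->|]; last exact: partitionD1.
by rewrite (partition_setD1_set0 partP) setD0.
Qed.

End SetPartition.

Section PartitionInsert.
Variables (T : finType) (x : T) (D : {set T}).
Hypothesis xD : x \notin D.
Implicit Types (C : {set T}) (P Q : {set {set T}}).

(* [QC.2] is the block of [QC.1] that receives [x], or [set0] if [x] is to form
   a block by itself. *)
Definition partition_insert (QC : {set {set T}} * {set T}) : {set {set T}} :=
  (x |: QC.2) |: (QC.1 :\ QC.2).

Definition partition_delete P : {set {set T}} * {set T} :=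
  let C := pblock P x :\ x in ((C |: (P :\ pblock P x)) :\ set0, C).

Definition pointed_partition (QC : {set {set T}} * {set T}) : bool :=
  partition QC.1 D && (QC.2 \in set0 |: QC.1).

Lemma pointed_partition_sub Q C : pointed_partition (Q, C) -> C \subset D.
Proof.
case/andP=> /= partQ; rewrite !inE => /predU1P[->|]; first exact: sub0set.
exact: partitionS.
Qed.

Lemma pointed_partition_notin Q C :
  pointed_partition (Q, C) -> x |: C \notin Q :\ C.
Proof.
case/andP=> /= partQ _.
by rewrite !inE negb_and (partition_notin partQ _ xD) ?setU11 ?orbT.
Qed.

Lemma partition_insert_partition QC :
  pointed_partition QC -> partition (partition_insert QC) (x |: D).
Proof.
case: QC => Q C ptQC; have sCD := pointed_partition_sub ptQC.
case/andP: ptQC => /= partQ CQ.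
have -> : x |: D = (x |: C) :|: (D :\: C).
  by rewrite -setUA -{1}(setID D C) (setIidPr sCD).
apply: partitionU1 (partitionD1_set0U partQ CQ) _ _.
  by apply/set0Pn; exists x; rewrite setU11.
rewrite -setI_eq0; apply/eqP/setP=> y; rewrite !inE.
by have [->|_] := eqVneq y x; [rewrite (negPf xD) andbF | case: (y \in C)].
Qed.

Lemma partition_insertK :
  {in pointed_partition, cancel partition_insert partition_delete}.
Proof.
case=> Q C ptQC.
have xC := contraNN (subsetP (pointed_partition_sub ptQC) x) xD.
have pblockE : pblock (partition_insert (Q, C)) x = x |: C.
  apply: def_pblock; rewrite ?setU11 //.
  exact: partition_trivIset (partition_insert_partition ptQC).
rewrite /partition_delete pblockE setU1K // setU1K ?pointed_partition_notin //.
case/andP: ptQC => /= partQ CQ; congr pair; apply/setP=> B; rewrite !inE.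
have [->|B_neq0] /= := eqVneq B set0; first by rewrite (partition0 partQ).
have [eqBC|//] := eqVneq B C; move: B_neq0; rewrite {B}eqBC.
by case/setU1P: CQ => ->; rewrite ?eqxx.
Qed.

Lemma pblock_setU1P P :
  partition P (x |: D) -> pblock P x \in P /\ x \in pblock P x.
Proof.
move=> partP; have x_cover : x \in cover P.
  by rewrite (cover_partition partP) setU11.
by rewrite pblock_mem // mem_pblock.
Qed.

Lemma partition_delete_pointed P :
  partition P (x |: D) -> pointed_partition (partition_delete P).
Proof.
move=> partP; rewrite /partition_delete; have [] := pblock_setU1P partP.
set B := pblock P x => BP xB; apply/andP; split=> /=; last first.
  by rewrite !inE; case: (B :\ x =P set0) => //=; rewrite eqxx.
have -> : D = (B :\ x) :|: ((x |: D) :\: B).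
  apply/setP=> y; rewrite !inE; have [->|y_neq_x] := eqVneq y x.
    by rewrite xB (negPf xD).
  have [yB|] //= := boolP (y \in B).
  by have /setU1P[/eqP/idPn|] := subsetP (partitionS partP BP) y yB.
apply: partitionU1_setD1_set0 (partitionD1 partP BP) _.
rewrite -setI_eq0; apply/eqP/setP=> y; rewrite !inE.
by case: (y \in B); rewrite ?andbF.
Qed.

Lemma partition_deleteK P :
  partition P (x |: D) -> partition_insert (partition_delete P) = P.
Proof.
move=> partP; rewrite /partition_insert /partition_delete /=.
have [] := pblock_setU1P partP; set B := pblock P x => BP xB.
have partPB := partitionD1 partP BP.
have BxP : B :\ x \notin P :\ B.
  have [->|[y yBx]] := set_0Vmem (B :\ x); first by rewrite (partition0 partPB).
  apply: (partition_notin partPB yBx).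
  by move: yBx; rewrite !inE => /andP[_ ->].
rewrite setDDl (setUC [set set0]) -setDDl setU1K //.
by rewrite (partition_setD1_set0 partPB) setD1K // setD1K.
Qed.

Lemma card_partition_insert Q C :
  pointed_partition (Q, C) ->
  #|partition_insert (Q, C)| = (#|Q| + (C == set0))%N.
Proof.
move=> ptQC; rewrite cardsU1 pointed_partition_notin //=.
case/andP: ptQC => /= partQ; rewrite (cardsD1 C Q).
case/setU1P=> [->|CQ]; first by rewrite (partition0 partQ) eqxx addnC.
by rewrite CQ (negPf (partition_neq0 partQ CQ)) addn0.
Qed.

(* Inserting [x] into a partition with [k] blocks yields one partition with
   [k + 1] blocks and [k] partitions with [k] blocks. *)
Lemma big_partition_setU1 (V : nmodType) (F : nat -> V) :
  \sum_(P | partition P (x |: D)) F #|P| =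
  \sum_(Q | partition Q D) (F #|Q|.+1 + F #|Q| *+ #|Q|).
Proof.
rewrite (reindex_onto partition_insert partition_delete partition_deleteK).
have pointedE QC :
    partition (partition_insert QC) (x |: D)
      && (partition_delete (partition_insert QC) == QC) = pointed_partition QC.
  apply/andP/idP => [[partQC /eqP <-]|ptQC].
    exact: partition_delete_pointed.
  by rewrite partition_insert_partition // partition_insertK.
transitivity (\sum_(QC | partition QC.1 D && (QC.2 \in set0 |: QC.1))
                F (#|QC.1| + (QC.2 == set0))%N).
  rewrite (eq_bigl _ _ pointedE).
  by apply: eq_bigr => -[Q C] /card_partition_insert ->.
rewrite -(pair_big_dep (fun Q => partition Q D) (fun Q C => C \in set0 |: Q)
  (fun Q C => F (#|Q| + (C == set0))%N)) /=.
apply: eq_bigr => Q partQ; rewrite big_setU1 ?(partition0 partQ) //=.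
rewrite eqxx addn1 -sumr_const; congr +%R; apply: eq_bigr => C CQ.
by rewrite (negPf (partition_neq0 partQ CQ)) addn0.
Qed.

End PartitionInsert.

Lemma big_partition_card (V : nmodType) (T : finType) (D : {set T})
    (F : nat -> V) :
  \sum_(P | partition P D) F #|P| =
  iter #|D| (fun G k => G k.+1 + G k *+ k) F 0%N.
Proof.
move: {2}#|D| (erefl #|D|) => n cardD.
elim: n => [|n IHn] in D cardD F *.
  have {cardD} -> : D = set0 by apply/eqP; rewrite -cards_eq0 cardD.
  rewrite cards0 (big_pred1 set0) ?cards0 // => P.
  exact: partition_set0.
have /set0Pn[x xD] : D != set0 by rewrite -card_gt0 cardD.
have xDx : x \notin D :\ x by rewrite !inE eqxx.
have cardDx : #|D :\ x| = n by move: cardD; rewrite (cardsD1 x D) xD => -[].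
rewrite cardD iterSr -cardDx -IHn // -(big_partition_setU1 xDx F).
by rewrite setD1K.
Qed.

Lemma big_partition_ordS (V : nmodType) n (F : nat -> V) :
  \sum_(P | partition P [set: 'I_n.+1]) F #|P| =
  \sum_(Q | partition Q [set: 'I_n]) (F #|Q|.+1 + F #|Q| *+ #|Q|).
Proof.
rewrite (big_partition_card [set: 'I_n.+1]) cardsT card_ord iterSr.
by rewrite (big_partition_card [set: 'I_n] (fun k => F k.+1 + F k *+ k))
  cardsT card_ord.
Qed.

Lemma stirling2E j m :
  stirling2 j m = (\sum_(P | partition P [set: 'I_j]) (#|P| == m))%N.
Proof.
rewrite /stirling2 -sum1_card big_mkcond [RHS]big_mkcond /=.
by apply: eq_bigr => P _; rewrite inE; case: (partition _ _); case: eqP.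
Qed.

Lemma stirling2S0 j : stirling2 j.+1 0 = 0%N.
Proof.
rewrite stirling2E (big_partition_ordS j (fun k => (k == 0) : nat)).
by apply: big1 => Q _; case: #|Q| => // k; rewrite mul0rn.
Qed.

Lemma stirling2SS j m :
  stirling2 j.+1 m.+1 = (stirling2 j m + m.+1 * stirling2 j m.+1)%N.
Proof.
rewrite !stirling2E (big_partition_ordS j (fun k => (k == m.+1) : nat)).
rewrite big_distrr -big_split /=; apply: eq_bigr => Q _.
rewrite -mulr_natr !ssralg.natrE eqSS mulnC.
by have [->|_] := eqVneq #|Q| m.+1; rewrite ?muln0.
Qed.

Section FallingPolynomial.
Variable R : nzRingType.

Definition falling_poly n : {poly R} := \prod_(i < n) ('X - i%:R%:P).

Lemma falling_poly0 : falling_poly 0 = 1.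
Proof. exact: big_ord0. Qed.

Lemma falling_polyD m n :
  falling_poly (m + n) = falling_poly m * \prod_(i < n) ('X - (m + i)%:R%:P).
Proof. exact: big_split_ord. Qed.

Lemma falling_polyS n : falling_poly n.+1 = falling_poly n * ('X - n%:R%:P).
Proof. exact: big_ord_recr. Qed.

End FallingPolynomial.

Section MomentFunctional.
Variable R : comNzRingType.
Implicit Types (u : nat -> R) (g : {poly R}).

Definition moment_functional u g : R := \sum_(j < size g) g`_j * u j.

Lemma moment_functional_wide n u g : (size g <= n)%N ->
  moment_functional u g = \sum_(j < n) g`_j * u j.
Proof.
move=> le_gn; rewrite /moment_functional.
rewrite (big_ord_widen n (fun j => g`_j * u j) le_gn).
rewrite big_mkcond /=; apply: eq_bigr => j _.
by case: ltnP => // /(nth_default 0) ->; rewrite mul0r.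
Qed.

Lemma moment_functional_is_scalar u : scalar (moment_functional u).
Proof.
move=> c g h; pose n := maxn (size g) (size h).
rewrite !(@moment_functional_wide n) ?leq_maxl ?leq_maxr //; last first.
  rewrite (leq_trans (size_polyD _ _)) // geq_max leq_maxr andbT.
  by rewrite (leq_trans (size_scale_leq _ _)) ?leq_maxl.
rewrite mulr_sumr -big_split; apply: eq_bigr => j _ /=.
by rewrite coefD coefZ mulrDl mulrA.
Qed.

HB.instance Definition _ u :=
  GRing.isLinear.Build R {poly R} R *%R (moment_functional u)
    (moment_functional_is_scalar u).

Lemma moment_functionalXn u j : moment_functional u 'X^j = u j.
Proof.
rewrite /moment_functional size_polyXn big_ord_recr /= coefXn eqxx mul1r.
rewrite big1 ?add0r // => i _.
by rewrite coefXn (ltn_eqF (ltn_ord i)) mul0r.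
Qed.

Lemma moment_functional_mulXsubC u c g :
  moment_functional u (('X - c%:P) * g) =
  moment_functional (fun j => u j.+1 - c * u j) g.
Proof.
rewrite mulrBl linearB /= mul_polyC linearZ /=.
rewrite (@moment_functional_wide (size g).+1); last first.
  by rewrite (leq_trans (size_polyMleq _ _)) // size_polyX.
rewrite big_ord_recl coefXM mul0r add0r mulr_sumr -sumrB.
by apply: eq_bigr => j _; rewrite coefXM mulrBr (mulrCA c).
Qed.

Lemma eq_moment_functional u v g :
  u =1 v -> moment_functional u g = moment_functional v g.
Proof. by move=> eq_uv; apply: eq_bigr => j _; rewrite eq_uv. Qed.

Definition stirling2_functional m : {poly R} -> R :=
  moment_functional (fun j => (stirling2 j m)%:R).

HB.instance Definition _ m := GRing.Linear.on (stirling2_functional m).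

Lemma stirling2_functional_mul_falling_poly m g :
  stirling2_functional m (falling_poly R m.+1 * g) = 0.
Proof.
rewrite /stirling2_functional.
elim: m g => [|m IHm] g; rewrite falling_polyS.
  rewrite falling_poly0 mul1r moment_functional_mulXsubC.
  by apply: big1 => j _; rewrite stirling2S0 mul0r subrr mulr0.
rewrite -mulrA mulrCA moment_functional_mulXsubC.
rewrite -[RHS](IHm g); apply: eq_moment_functional => j.
by rewrite stirling2SS natrD natrM addrK.
Qed.

Lemma stirling2_functional_XaddC_exp m c n :
  stirling2_functional m (('X + c%:P) ^+ n) =
  \sum_(j < n.+1) 'C(n, j)%:R * (stirling2 j m)%:R * c ^+ (n - j).
Proof.
rewrite addrC exprDn linear_sum /=; apply: eq_bigr => j _.
rewrite raddfMn /= -polyC_exp mul_polyC linearZ /=.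
rewrite [stirling2_functional _ _]moment_functionalXn.
by rewrite -[LHS]mulr_natl (mulrC (c ^+ _)) mulrA.
Qed.

End MomentFunctional.

Lemma dvdp_falling_poly (R : idomainType) m n :
  (m <= n)%N -> falling_poly R m %| falling_poly R n.
Proof. by move/subnKC <-; rewrite falling_polyD dvdp_mulIl. Qed.

Lemma mulr_exprB1 (R : pzRingType) (x : R) n :
  (0 < n)%N -> x * (x ^+ (n - 1) - 1) = x ^+ n - x.
Proof. by move=> n_gt0; rewrite mulrBr mulr1 -exprS subn1 prednK. Qed.

Lemma exprB_pchar (R : comNzRingType) (x y : R) n :
  [pchar R].-nat n -> (x - y) ^+ n = x ^+ n - y ^+ n.
Proof. by move=> pcharRn; rewrite exprDn_pchar // exprNn_pchar. Qed.

Lemma pFrobenius_sub_addz (R : comNzRingType) p (x : R) (a : int) :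
  p \in [pchar R] -> (x + a%:~R) ^+ p - (x + a%:~R) = x ^+ p - x.
Proof.
move=> pcharRp; rewrite -!(pFrobenius_autE pcharRp) rmorphD /=.
by rewrite pFrobenius_aut_int opprD addrACA subrr addr0.
Qed.

Lemma dvdp_exprB_pchar (R : idomainType) (Y : {poly R}) (p d e k q l l' : nat) :
  p \in [pchar R] -> (k <= l)%N -> (q <= p ^ e)%N -> (l <= l')%N ->
  (l' = l %[mod d * p ^ e])%N ->
  Y ^+ k * (Y ^+ d - 1) ^+ q %| Y ^+ l' - Y ^+ l.
Proof.
move=> pcharRp le_kl le_q le_ll' /eqP.
rewrite eqn_mod_dvd // => /dvdnP[n l'_eq].
have -> : Y ^+ l' - Y ^+ l = Y ^+ l * ((Y ^+ (d * p ^ e)) ^+ n - 1).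
  by rewrite mulrBr mulr1 -exprM -exprD mulnC -l'_eq subnKC.
apply: dvdp_mul; first exact: dvdp_exp2l.
apply: dvdp_trans (dvdp_exp2l _ le_q) _.
have pchar_nat : [pchar {poly R}].-nat (p ^ e)%N.
  by rewrite pnatX pnatE ?(pcharf_prime pcharRp) // pchar_poly pcharRp.
rewrite exprB_pchar // expr1n exprM; move: (_ ^+ (p ^ e)) => z.
by rewrite -[in z ^+ n - 1](expr1n _ n) subrXX dvdp_mulIl.
Qed.

Section FallingPolyFp.
Variable p : nat.
Hypothesis p_prime : prime p.

Lemma falling_poly_Fp : falling_poly 'F_p p = 'X^p - 'X.
Proof.
have := finField_genPoly 'F_p; rewrite card_Fp // /falling_poly => ->.
rewrite -(big_mkord xpredT (fun i => 'X - i%:R%:P)).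
rewrite -[X in \prod_(0 <= i < X) _](Fp_cast p_prime) big_mkord.
by apply: eq_bigr => i _; rewrite natr_Zp.
Qed.

Lemma falling_poly_mul_Fp q : falling_poly 'F_p (q * p) = ('X^p - 'X) ^+ q.
Proof.
elim: q => [|q IHq]; first exact: falling_poly0.
rewrite mulSn addnC falling_polyD IHq exprSr -falling_poly_Fp; congr (_ * _).
by apply: eq_bigr => i _; rewrite natrD natrM pchar_Fp_0 // mulr0 add0r.
Qed.

Lemma dvdp_falling_poly_exprB (a : int) (e l l' m : nat) :
  (m %/ p < l)%N -> (m < p ^ e.+1)%N -> (l <= l')%N ->
  (l' = l %[mod (p - 1) * p ^ e])%N ->
  falling_poly 'F_p m.+1 %| ('X + a%:~R%:P) ^+ l' - ('X + a%:~R%:P) ^+ l.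
Proof.
move=> lt_mpl lt_mpe le_ll' eq_ll'.
apply: dvdp_trans (dvdp_falling_poly _ (ltn_ceil m (prime_gt0 p_prime))) _.
rewrite falling_poly_mul_Fp.
have pchar_poly_p : p \in [pchar {poly 'F_p}] by rewrite pchar_poly pchar_Fp.
rewrite -(pFrobenius_sub_addz 'X a pchar_poly_p) -(rmorph_int polyC) /=.
rewrite -mulr_exprB1 ?prime_gt0 // exprMn; apply: dvdp_exprB_pchar eq_ll' => //.
  exact: pchar_Fp.
by rewrite ltn_divLR ?prime_gt0 // -expnSr.
Qed.

Lemma dvdp_falling_poly_exprB_X (e l l' : nat) :
  (p ^ e < l)%N -> (l <= l')%N -> (l' = l %[mod (p - 1) * p ^ e])%N ->
  falling_poly 'F_p (p ^ e.+1).+1 %| 'X^l' - 'X^l.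
Proof.
move=> lt_pel le_ll' eq_ll'.
rewrite falling_polyS expnSr falling_poly_mul_Fp.
rewrite natrM pchar_Fp_0 // mulr0 subr0.
rewrite -mulr_exprB1 ?prime_gt0 // exprMn mulrAC -exprSr.
by apply: dvdp_exprB_pchar eq_ll' => //; apply: pchar_Fp.
Qed.

End FallingPolyFp.

Lemma dvdp_falling_poly_exprB_delta (p : nat) (a : int) (l l' m : nat) :
  prime p -> (0 < m)%N -> (m %/ p < l)%N -> (l <= l')%N ->
  (l' = l %[mod (p - 1) * p ^ (trunc_log p m - delta p a m)])%N ->
  falling_poly 'F_p m.+1 %| ('X + a%:~R%:P) ^+ l' - ('X + a%:~R%:P) ^+ l.
Proof.
move=> p_prime m_gt0 lt_mpl le_ll'.
rewrite /delta; case: ifP => [/and3P[p_dvd_a log_gt0 /eqP m_def]|_] eq_ll'.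
  have /eqP-> : a%:~R == 0 :> 'F_p by rewrite -(dvdz_pcharf (pchar_Fp p_prime)).
  rewrite addr0; case: (trunc_log p m) log_gt0 m_def eq_ll' => // e _ m_def.
  rewrite (subn1 e.+1) => eq_ll'; rewrite -m_def in lt_mpl *.
  apply: dvdp_falling_poly_exprB_X eq_ll' => //.
  by move: lt_mpl; rewrite expnSr mulnK ?prime_gt0.
rewrite subn0 in eq_ll'; apply: dvdp_falling_poly_exprB eq_ll' => //.
by have /andP[] := trunc_log_bounds (prime_gt1 p_prime) m_gt0.
Qed.

Theorem theorem1p1 (p : nat) (a : int) (l l' m : nat)
    (p_prime : prime p)
    (l_gt0 : (0 < l)%N) (l'_gt0 : (0 < l')%N) (m_gt0 : (0 < m)%N)
    (le_l_l' : (l <= l')%N)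
    (lt_mp_l : m%:R / p%:R < l%:R :> rat)
    (eq_l_l' : (l' = l %[mod (p - 1) * p ^ (trunc_log p m - delta p a m)])%N) :
  (\sum_(j < l'.+1) 'C(l', j)%:Z * (stirling2 j m)%:Z * a ^+ (l' - j)
   = \sum_(j < l.+1) 'C(l, j)%:Z * (stirling2 j m)%:Z * a ^+ (l - j)
   %[mod p%:Z])%Z.
Proof.
have {}lt_mp_l : (m %/ p < l)%N.
  move: lt_mp_l; rewrite ltr_pdivrMr ?ltr0n ?prime_gt0 //.
  by rewrite -natrM ltr_nat ltn_divLR ?prime_gt0.
have sumE n :
    (\sum_(j < n.+1) 'C(n, j)%:Z * (stirling2 j m)%:Z * a ^+ (n - j))%:~R
    = stirling2_functional m (('X + a%:~R%:P) ^+ n) :> 'F_p.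
  rewrite stirling2_functional_XaddC_exp rmorph_sum /=; apply: eq_bigr => j _.
  by rewrite !rmorphM rmorphXn.
apply/eqP; rewrite eqz_mod_dvd (dvdz_pcharf (pchar_Fp p_prime)).
rewrite rmorphB /= !sumE.
have /dvdpP[g div_g] :=
  dvdp_falling_poly_exprB_delta p_prime m_gt0 lt_mp_l le_l_l' eq_l_l'.
by rewrite -linearB div_g mulrC /= stirling2_functional_mul_falling_poly.
Qed.
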